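(* Let $(Q^n)_{n\in\overline{\mathbb N}}$ be transition kernels on $\mathbb X$ and let $(f^n)_{n\in\overline{\mathbb N}}$ be non-negative reward functions with $\sup_{n\in\overline{\mathbb N}}\|f^n\|_\infty<\infty$. Assume the discount function satisfies $\delta(t+s)\ge\delta(t)\delta(s)$ for all $s,t\in\mathbb N$. Suppose that $Q^n$ converges to $Q^\infty$ locally uniformly in total variation and that $f^n$ converges to $f^\infty$ locally uniformly. Then $$S^*(f^\infty,Q^\infty)\subset\liminf_{n\to\infty}S^*(f^n,Q^n),$$ and $$V^{Q^\infty}(x,f^\infty)\ge\limsup_{n\to\infty}V^{Q^n}(x,f^n),\qquad\forall x\in\mathbb X.$$
   Context: $\mathbb X$ is a Polish space with Borel $\sigma$-algebra $\mathcal B$; $\mathbb N=\{0,1,2,\dots\}$, $\overline{\mathbb N}=\mathbb N\cup\{\infty\}$. $X=(X_t)_{t\in\mathbb N}$ is a time-homogeneous discrete-time Markov process with values in $\mathbb X$. For a transition kernel $Q$ on $\mathbb X$, $\mathbb E^Q_x$ is the expectation when $X$ has transition kernel $Q$ and $X_0=x$. The discount function $\delta:\mathbb N\to[0,1]$ is fixed, decreasing (in the weak sense), with $\delta(0)=1$, $\delta(1)<1$, $\lim_{t\to\infty}\delta(t)=0$. A reward function is a Borel function $f:\mathbb X\to[0,\infty)$ (possibly discontinuous); $\|f\|_\infty=\sup_{x}|f(x)|$. Convention: $\delta(\tau)f(X_\tau)=0$ on $\{\tau=\infty\}$. For $S\in\mathcal B$ let $\rho(S)=\inf\{t\ge1: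 X_t\in S\}$ ($\inf\emptyset=\infty$) and $J^Q(x,S,f)=\mathbb E^Q_x[\delta(\rho(S))f(X_{\rho(S)})]$ if $x\notin S$, $J^Q(x,S,f)=f(x)$ if $x\in S$. $S\in\mathcal B$ is an equilibrium w.r.t. $f$ and $Q$ if $f(x)\le\mathbb E^Q_x[\delta(\rho(S))f(X_{\rho(S)})]$ for all $x\notin S$ and $f(x)\ge\mathbb E^Q_x[\delta(\rho(S))f(X_{\rho(S)})]$ for all $x\in S$. $\mathcal E^Q(f)$ is the set of equilibria. Put $V^Q(x,f)=\sup_{S\in\mathcal E^Q(f)}J^Q(x,S,f)$ and $S^*(f,Q)=\bigcap_{S\in\mathcal E^Q(f)}S$. Total variation: $\|\mu-\nu\|_{TV}=\sup\{\int g\,d\mu-\int g\,d\nu\}$ over Borel $g:\mathbb X\to[0,1]$. $Q^n\to Q^\infty$ locally uniformly in total variation means $\lim_{n\to\infty}\sup_{x\in K}\|Q^n(x,\cdot)-Q^\infty(x,\cdot)\|_{TV}=0$ for every compact $K\subset\mathbb X$. $f^n\to f^\infty$ locally uniformly means $\lim_{n\to\infty}\sup_{x\in K}|f^n(x)-f^\infty(x)|=0$ for every compact $K\subset\mathbb X$. For sets, $\liminf_{n\to\infty}A_n=\bigcup_{n<\infty}\bigcap_{n\le j<\infty}A_j$. *)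

(* Defs.v *)
From HB Require Import structures.
From mathcomp Require Import all_boot all_order all_algebra.
From mathcomp Require Import all_classical all_reals all_analysis.

Set Implicit Arguments.
Unset Strict Implicit.
Unset Printing Implicit Defensive.

Import Order.TTheory GRing.Theory Num.Theory.
Import numFieldNormedType.Exports.

Local Open Scope classical_set_scope.
Local Open Scope ring_scope.

(* N extended by infinity: [Some t] is the natural number t, [None] is oo. *)
Notation natbar := (option nat).

(* Together with the type constraint, this says that T is a (nonempty) Polish
   space: a uniform space given by a complete pseudometric is metrizable
   exactly when it is Hausdorff. A complete metric is part of T, but it is
   only used through the topology it induces. *)
Definition polish {R : realType} (T : completePseudoMetricType R) : Prop :=
  hausdorff_space T /\ exists2 D : set T, countable D & dense D.

Notation borel T := (g_sigma_algebraType (@open T)).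

Section MarkovProcesses.
Context {R : realType} {dT dO : measure_display}.
Context {T : measurableType dT} {Omega : measurableType dO}.

Implicit Types (X : nat -> Omega -> T) (P : T -> probability Omega R).
Implicit Types (Q : R.-pker T ~> T) (S : set T) (f : T -> R) (delta : nat -> R).

Definition natural_filtration X (t : nat) : set (set Omega) :=
  <<s [set A | exists2 s, (s <= t)%N &
               exists2 B, measurable B & A = X s @^-1` B] >>.

(* Under [P x], X is a time-homogeneous Markov process with transition
   kernel Q started at x. The last clause is the Markov property
   P_x(X_{t+1} \in B | sigma(X_0, ..., X_t)) = Q(X_t, B) almost surely, with
   the conditional probability spelled out. *)
Definition markov_process Q X P : Prop :=
  [/\ forall t, measurable_fun setT (X t),
      forall x, P x (X 0%N @^-1` [set x]) = 1%E &
      forall x t A B, natural_filtration X t A -> measurable B ->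
        P x (A `&` X t.+1 @^-1` B) = (\int[P x]_(w in A) Q (X t w) B)%E].

Definition hitting_time X S (w : Omega) : natbar :=
  match pselect (exists t, `[< (1 <= t)%N /\ S (X t w) >]) with
  | left h => Some (ex_minn h)
  | right _ => None
  end.

Definition stopped_reward delta X f (tau : Omega -> natbar) (w : Omega) : R :=
  if tau w is Some t then delta t * f (X t w) else 0.

(* E_x[delta(rho(S)) f(X_{rho(S)})] *)
Definition continuation_value delta X P (x : T) S f : \bar R :=
  (\int[P x]_w (stopped_reward delta X f (hitting_time X S) w)%:E)%E.

Definition J delta X P (x : T) S f : \bar R :=
  if x \in S then (f x)%:E else continuation_value delta X P x S f.

Definition equilibria delta X P f : set (set T) :=
  [set S | [/\ measurable S,
    forall x, ~ S x -> ((f x)%:E <= continuation_value delta X P x S f)%E &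
    forall x, S x -> ((f x)%:E >= continuation_value delta X P x S f)%E]].

Definition V delta X P (x : T) f : \bar R :=
  ereal_sup [set J delta X P x S f | S in equilibria delta X P f].

Definition Sstar delta X P f : set T :=
  \bigcap_(S in equilibria delta X P f) S.

Definition reward f : Prop := measurable_fun setT f /\ forall x, 0 <= f x.

Definition sup_norm f : \bar R := ereal_sup [set `|f x|%:E | x in setT].

Definition tv_dist (mu nu : {measure set T -> \bar R}) : \bar R :=
  ereal_sup [set (\int[mu]_y (g y)%:E - \int[nu]_y (g y)%:E)%E |
    g in [set g : T -> R | measurable_fun setT g /\ forall y, 0 <= g y <= 1]].

End MarkovProcesses.

Definition discount_function {R : realType} (delta : nat -> R) : Prop :=
  [/\ forall t, 0 <= delta t <= 1,
      forall s t, (s <= t)%N -> delta t <= delta s,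
      delta 0%N = 1,
      delta 1%N < 1 &
      delta t @[t --> \oo] --> (0 : R)].

(* The nonnegative functions [h n] tend to 0 uniformly on every compact set.
   The empty set is excluded because [ereal_sup set0 = -oo], whereas the
   supremum of nonnegative quantities over the empty set is meant to be 0. *)
Definition locally_uniformly_to0 {R : realType} {T : topologicalType}
    (h : nat -> T -> \bar R) : Prop :=
  forall K : set T, compact K -> K !=set0 ->
    ereal_sup [set h n x | x in K] @[n --> \oo] --> (0 : \bar R)%E.

Definition set_liminf {T : Type} (A : nat -> set T) : set T :=
  \bigcup_n \bigcap_(j >= n) A j.

(* Main.v *)
(** For a Borel set S write w_k(t, x) for the k-th backward iterate of the
    optimal stopping problem with discount shifted by t in which stopping is
    forced on S, started from the upper bound delta(t) M of all rewards. Let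
    S_0 be empty and let S_(m+1) add to S_m the points x at which f(x) is
    strictly larger than E_x[w_k(1, X_1)] for some k, with w_k taken for S_m.
    The union of the S_m is contained in every equilibrium. It is itself an
    equilibrium, hence equals S*: off it stopping is never better than
    continuing, and supermultiplicativity of delta propagates this to all later
    times, so the optimal value is that of the hitting time of S*. Neither
    stopping times nor measurable selections are needed. The iterates w_k are
    upper semicontinuous in (Q, f, S) by reverse Fatou, so the strict
    inequalities defining S_m persist under the perturbation, which gives the
    inclusion; the bounds J(x, E) <= w_(k+1)(0, x) <= V(x) + delta(k + 1) M,
    with w_(k+1) taken for S*, give the second claim. *)

Require Import Defs.
From HB Require Import structures.
From mathcomp Require Import all_boot all_order all_algebra.
From mathcomp Require Import all_classical all_reals all_analysis.
From mathcomp Require Import measurable_realfun.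
From mathcomp Require Import lra.

Set Implicit Arguments.
Unset Strict Implicit.
Unset Printing Implicit Defensive.

Import Order.TTheory GRing.Theory Num.Theory.
Import numFieldNormedType.Exports.

Local Open Scope classical_set_scope.
Local Open Scope ring_scope.

(** * Integration against a mixture of kernels *)

Section Disintegration.
Import HBNNSimple.
Local Open Scope ereal_scope.
Context {R : realType} {dT dO : measure_display}.
Context {T : measurableType dT} {Omega : measurableType dO}.
Variables (mu : {measure set Omega -> \bar R}) (nu : {measure set T -> \bar R}).
Variable kappa : Omega -> {measure set T -> \bar R}.
Hypothesis mkappa : forall B, measurable B -> measurable_fun [set: Omega] (fun w => kappa w B).
Variable A : set Omega.
Hypothesis mA : measurable A.
Hypothesis nuE : forall B, measurable B -> nu B = \int[mu]_(w in A) kappa w B.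

Lemma nnsfun_disintegration (g : {nnsfun T >-> R}) :
  \int[nu]_y (g y)%:E = \int[mu]_(w in A) \int[kappa w]_y (g y)%:E.
Proof.
have mg r : measurable (g @^-1` [set r]) by [].
rewrite integralT_nnsfun sintegralE.
under [RHS]eq_integral do rewrite integralT_nnsfun sintegralE.
rewrite ge0_integral_fsum//; last 2 first.
- move=> r; apply: measurable_funeM; apply: measurable_funTS; exact: mkappa.
- move=> r w _.
  by have := mulemu_ge0 (fun n => g @^-1` [set n]); apply; exact: preimage_nnfun0.
(* A scalar is pulled out of the integral only when [r] is nonnegative; a negative [r] is not a
   value of [g], so its terms vanish on both sides. *)
apply: eq_fsbigr => r _; rewrite nuE//.
have [r0|r0] := leP 0%R r.
  rewrite ge0_integralZl//; last by apply: measurable_funTS; exact: mkappa.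
by rewrite preimage_nnfun0// !integral0_eq ?mule0// => w _; rewrite measure0 ?mule0.
Qed.

(** The simple approximations of [g] do not depend on the measure, so monotone convergence applies
    under [nu], under each [kappa w], and finally under [mu]. *)
Lemma ge0_disintegration (g : T -> \bar R) :
    (forall y, 0 <= g y) -> measurable_fun setT g ->
  \int[nu]_y g y = \int[mu]_(w in A) \int[kappa w]_y g y.
Proof.
move=> g0 mg.
pose g_ := nnsfun_approx measurableT mg.
have ndg y : {homo (fun n => (g_ n y)%:E) : m n / (m <= n)%N >-> m <= n}.
  by move=> m n mn; rewrite lee_fin; exact/lefP/nd_nnsfun_approx.
have gE (m : {measure set T -> \bar R}) :
    \int[m]_y g y = limn (fun n => \int[m]_y (g_ n y)%:E).
  transitivity (\int[m]_y limn (fun n => (g_ n y)%:E)).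
    by apply: eq_integral => y _; apply/esym/cvg_lim => //; exact: cvg_nnsfun_approx.
  apply: monotone_convergence => //.
  - by move=> n; exact/measurable_EFinP.
  - by move=> n y _; rewrite lee_fin.
rewrite gE; under eq_fun do rewrite nnsfun_disintegration.
under [RHS]eq_integral do rewrite gE.
apply/esym/monotone_convergence => //.
- move=> n; apply: measurable_funTS.
  apply: measurable_fun_integral_kernel => //.
  + by move=> y; rewrite lee_fin.
  + exact/measurable_EFinP.
- by move=> n w _; apply: integral_ge0 => y _; rewrite lee_fin.
- move=> w _ m n mn; apply: ge0_le_integral => //.
  + by move=> y _; rewrite lee_fin.
  + exact/measurable_EFinP.
  + exact/measurable_EFinP.
  + by move=> y _; exact: ndg.
Qed.

End Disintegration.

(** * Bounded measurable functions and upper limits of their integrals *)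

Section BoundedFunctions.
Context {R : realType} {d : measure_display} {T : measurableType d}.
Implicit Types (mu nu : {measure set T -> \bar R}) (C : R) (g h : T -> R).

Definition bounded_by C h := measurable_fun setT h /\ forall y, 0 <= h y <= C.

Lemma bounded_by_integrable mu D C h :
  mu setT = 1%E -> measurable D -> bounded_by C h -> mu.-integrable D (EFin \o h).
Proof.
move=> mu1 mD [mh hC]; apply: (integrableS measurableT) => //.
apply: measurable_bounded_integrable => //; first by rewrite mu1 ltry.
exists C; split; first exact: num_real.
move=> c Cc y _ /=; have /andP[h0 hC'] := hC y.
by rewrite ger0_norm// (le_trans hC')// ltW.
Qed.

Lemma EFin_Rintegral mu D C h :
    mu setT = 1%E -> measurable D -> bounded_by C h ->
  (\int[mu]_(y in D) h y)%:E = (\int[mu]_(y in D) (h y)%:E)%E.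
Proof.
move=> mu1 mD bh; rewrite /Rintegral fineK//.
by apply: integrable_fin_num => //; exact: bounded_by_integrable bh.
Qed.

Lemma Rintegral_prob_cst mu C : mu setT = 1%E -> \int[mu]_y C = C.
Proof. by move=> mu1; rewrite Rintegral_cst// mu1/= mulr1. Qed.

Lemma bounded_by_cst C : 0 <= C -> bounded_by C (cst C : T -> R).
Proof. by move=> C0; split => // y; rewrite C0 lexx. Qed.

Lemma Rintegral_bounded mu C h :
  mu setT = 1%E -> bounded_by C h -> 0 <= \int[mu]_y h y <= C.
Proof.
move=> mu1 bh; have hC y : 0 <= h y <= C by have [] := bh.
have C0 : 0 <= C by have /andP[] := hC point; exact: le_trans.
apply/andP; split; first by apply: Rintegral_ge0 => y _; have /andP[] := hC y.
rewrite -[leRHS](Rintegral_prob_cst C mu1); apply: le_Rintegral => //.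
- exact: bounded_by_integrable bh.
- exact: bounded_by_integrable (bounded_by_cst C0).
- by move=> y _; have /andP[] := hC y.
Qed.

Lemma le_Rintegral_bounded mu C C' g h : mu setT = 1%E ->
    bounded_by C g -> bounded_by C' h -> (forall y, g y <= h y) ->
  \int[mu]_y g y <= \int[mu]_y h y.
Proof.
move=> mu1 bg bh gh; apply: le_Rintegral => //.
- exact: bounded_by_integrable bg.
- exact: bounded_by_integrable bh.
Qed.

Lemma bounded_by_max C g h :
  bounded_by C g -> bounded_by C h -> bounded_by C (fun y => Num.max (g y) (h y)).
Proof.
move=> [mg gC] [mh hC]; split; first exact: measurable_maxr.
move=> y; have /andP[g0 gC'] := gC y; have /andP[h0 hC'] := hC y.
by rewrite le_max g0 ge_max gC' hC'.
Qed.

(** Dividing [h] by [C] gives a test function admissible in [tv_dist]; scaling back multiplies the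
    error by [C]. *)
Lemma le_Rintegral_tv mu nu C h (e : R) : mu setT = 1%E -> nu setT = 1%E ->
    0 < C -> bounded_by C h -> (tv_dist mu nu <= e%:E)%E ->
  \int[mu]_y h y <= \int[nu]_y h y + C * e.
Proof.
move=> mu1 nu1 C0 bh tve; have [mh hC] := bh.
pose g y := C^-1 * h y.
have hg : h = (fun y => C * g y).
  by apply/funext => y; rewrite /g mulrA divff ?mul1r// gt_eqF.
have bg : bounded_by 1 g.
  split; first exact: measurable_funM.
  move=> y; have /andP[h0 hC'] := hC y; rewrite /g.
  by rewrite mulr_ge0//= ?invr_ge0 ?(ltW C0)// mulrC ler_pdivrMr// mul1r.
move: g hg bg {bh mh hC} => g -> bg.
have {tve} : ((\int[mu]_y g y)%:E - (\int[nu]_y g y)%:E <= e%:E)%E.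
  rewrite !(EFin_Rintegral _ _ bg)//.
  by apply: le_trans tve; apply: ereal_sup_ubound; exists g.
rewrite -EFinB lee_fin !RintegralZl//; last 2 first.
- exact: bounded_by_integrable bg.
- exact: bounded_by_integrable bg.
by rewrite -lerBlDl -mulrBr ler_pM2l.
Qed.

(** The upper limit in epsilon form, which stays within the reals and combines directly with other
    eventual bounds. *)
Definition limsup_le (a : nat -> R) (b : R) :=
  forall e, 0 < e -> \forall n \near \oo, a n <= b + e.

(* Dominate [h_ n] by [max (h_ n) h], which converges boundedly to [h]. *)
Lemma limsup_le_Rintegral (mu_ : nat -> {measure set T -> \bar R}) mu C
    (h_ : nat -> T -> R) h :
    (forall n, mu_ n setT = 1%E) -> mu setT = 1%E -> 0 < C ->
    (forall n, bounded_by C (h_ n)) -> bounded_by C h ->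
    (forall e, 0 < e -> \forall n \near \oo, (tv_dist (mu_ n) mu <= e%:E)%E) ->
    (forall y, limsup_le (h_ ^~ y) (h y)) ->
  limsup_le (fun n => \int[mu_ n]_y h_ n y) (\int[mu]_y h y).
Proof.
move=> mu1_ mu1 C0 bh_ bh tv0 hh e e0.
pose g n y := Num.max (h_ n y) (h y).
have bg n : bounded_by C (g n) by exact: bounded_by_max.
have gh y : (g n y)%:E @[n --> \oo] --> (h y)%:E.
  apply: cvg_EFin; first by apply: nearW.
  apply/cvgrPdist_le => eps eps0; near=> n.
  rewrite distrC ger0_norm; last by rewrite subr_ge0 /g le_max lexx orbT.
  rewrite lerBlDl /g ge_max lerDl (ltW eps0) andbT.
  by near: n; exact: hh.
have cvg_g : \int[mu]_y g n y @[n --> \oo] --> \int[mu]_y h y.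
  have [] := @dominated_convergence _ T R mu setT measurableT
    (fun n y => (g n y)%:E) (EFin \o h) (cst C%:E).
  - by move=> n; apply/measurable_EFinP; have [] := bg n.
  - by apply/measurable_EFinP; have [] := bh.
  - by apply: aeW => y _; exact: gh.
  - exact: bounded_by_integrable (bounded_by_cst (ltW C0)).
  - apply: aeW => y n _; have [_ /(_ y)/andP[g0 gC]] := bg n.
    by rewrite /= lee_fin ger0_norm.
  move=> _ _; rewrite -(EFin_Rintegral _ _ bh)// => /fine_cvgP[_].
  exact.
(* Half of [e] pays for replacing [mu_ n] by [mu], where the tolerance [e / 2 / C] is multiplied by
   [C]; the other half pays for dominated convergence. *)
have e20 : 0 < e / 2 by rewrite divr_gt0.
have {}tv0 := tv0 _ (divr_gt0 e20 C0).
have {}cvg_g : \forall n \near \oo, `|\int[mu]_y h y - \int[mu]_y g n y| <= e / 2.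
  by move/cvgrPdist_le : cvg_g => /(_ _ e20).
near=> n.
apply: (@le_trans _ _ (\int[mu]_y h_ n y + C * (e / 2 / C))).
  by apply: le_Rintegral_tv => //; near: n; exact: tv0.
rewrite [C * _]mulrC divfK ?gt_eqF// [in leRHS](splitr e) addrA lerD2r.
apply: (@le_trans _ _ (\int[mu]_y g n y)).
  by apply: (le_Rintegral_bounded mu1 (bh_ n) (bg n)) => y; rewrite le_max lexx.
rewrite -lerBlDl; apply: le_trans (ler_norm _) _.
by rewrite distrC; near: n; exact: cvg_g.
Unshelve. all: by end_near. Qed.

End BoundedFunctions.

(** * Backward iterates of the optimal stopping problem *)

Section SnellEnvelope.
Context {R : realType} {dT : measure_display} {T : measurableType dT}.
Variables (delta : nat -> R) (M : R).
Hypothesis hdelta : discount_function delta.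
Hypothesis M_gt0 : 0 < M.
Implicit Types (Q : R.-pker T ~> T) (S E : set T) (f : T -> R).

(* With [f \_ S] in place of [f], stopping outside [S] pays nothing, and the
   iterates approximate the reward collected at the hitting time of [S]. *)
Fixpoint snell Q f S (k t : nat) (x : T) : R :=
  if k is k'.+1 then
    if x \in S then delta t * f x
    else Num.max (delta t * f x) (\int[Q x]_y snell Q f S k' t.+1 y)
  else delta t * M.

(** The upper approximation of the continuation value: the first step is compulsory because hitting
    times start at 1, so stopping at [x] itself is not on offer. *)
Definition snell_next Q f S (k : nat) (x : T) : R :=
  \int[Q x]_y snell Q f S k 1 y.

Let delta_ge0 t : 0 <= delta t.
Proof. by have [/(_ t)/andP[]] := hdelta. Qed.

Let delta_le1 t : delta t <= 1.
Proof. by have [/(_ t)/andP[]] := hdelta. Qed.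

Let delta_decr t : delta t.+1 <= delta t.
Proof. by have [_ /(_ t t.+1 (leqnSn t))] := hdelta. Qed.

Let kernel1 Q x : Q x setT = 1%E.
Proof. exact: prob_kernel. Qed.

Lemma measurable_fun_Rintegral_kernel Q C (h : T -> R) :
  bounded_by C h -> measurable_fun setT (fun x => \int[Q x]_y h y).
Proof.
move=> [mh hC]; apply: (measurableT_comp (fine_measurable measurableT)).
apply: (@measurable_fun_integral_kernel _ _ _ _ _ Q).
- exact: measurable_kernel.
- by move=> y; rewrite lee_fin; have /andP[] := hC y.
- exact/measurable_EFinP.
Qed.

Lemma measurable_fun_mem S :
  measurable S -> measurable_fun setT (fun x : T => x \in S).
Proof.
move=> mS; apply: (measurable_fun_bool true); rewrite setTI.
by rewrite (_ : _ @^-1` _ = S)//; apply/seteqP; split => x; [exact: set_mem|exact: mem_set].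
Qed.

Lemma snell_bounded Q f S k t :
  measurable S -> bounded_by M f -> bounded_by (delta t * M) (snell Q f S k t).
Proof.
move=> mS [mf fM]; elim: k t => [|k IH] t /=.
  by apply: bounded_by_cst; rewrite mulr_ge0// ltW.
have df x : 0 <= delta t * f x <= delta t * M.
  by have /andP[f0 fM'] := fM x; rewrite mulr_ge0//= ler_wpM2l.
have mdf : measurable_fun setT (fun x => delta t * f x) by exact: measurable_funM.
split.
  apply: measurable_fun_ifT; first exact: measurable_fun_mem.
  - exact: mdf.
  - by apply: measurable_maxr => //; exact: measurable_fun_Rintegral_kernel (IH t.+1).
move=> x; case: ifPn => // _; have /andP[df0 dfM] := df x.
rewrite le_max df0 ge_max dfM /=.
have /andP[_ /le_trans] := Rintegral_bounded (kernel1 Q x) (IH t.+1).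
by apply; rewrite ler_pM2r.
Qed.

Lemma snell_boundedM Q f S k t :
  measurable S -> bounded_by M f -> bounded_by M (snell Q f S k t).
Proof.
move=> mS bf; have [mw wM] := snell_bounded Q k t mS bf.
split => // x; have /andP[-> /le_trans] := wM x; apply.
by rewrite ler_piMl// ltW.
Qed.

Lemma measurable_snell_next Q f S k :
  measurable S -> bounded_by M f -> measurable_fun setT (snell_next Q f S k).
Proof.
by move=> mS bf; exact: measurable_fun_Rintegral_kernel (snell_boundedM Q k 1 mS bf).
Qed.

(** A larger set of forced stopping leaves fewer choices: at a point of [E] outside [S], the forced
    payoff is still one arm of the maximum for [S]. *)
Lemma le_snell Q f f' S E k t x : measurable S -> measurable E ->
    bounded_by M f -> bounded_by M f' -> (forall y, f y <= f' y) -> S `<=` E ->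
  snell Q f E k t x <= snell Q f' S k t x.
Proof.
move=> mS mE bf bf' ff' SE; elim: k t x => [|k IH] t x //=.
have dff' : delta t * f x <= delta t * f' x by rewrite ler_wpM2l.
case: ifPn => xE; case: ifPn => xS //.
- by rewrite le_max dff'.
- by move/negP: xE; rewrite !inE in xS *; case; exact: SE.
- rewrite ge_max !le_max dff'/=; apply/orP; right.
  exact: (le_Rintegral_bounded (kernel1 Q x) (snell_boundedM Q k t.+1 mE bf)
    (snell_boundedM Q k t.+1 mS bf')).
Qed.

Lemma le_snell_next Q f f' S E k x : measurable S -> measurable E ->
    bounded_by M f -> bounded_by M f' -> (forall y, f y <= f' y) -> S `<=` E ->
  snell_next Q f E k x <= snell_next Q f' S k x.
Proof.
move=> mS mE bf bf' ff' SE.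
apply: (le_Rintegral_bounded (kernel1 Q x) (snell_boundedM Q k 1 mE bf)
    (snell_boundedM Q k 1 mS bf')) => y.
exact: le_snell.
Qed.

Lemma restrict_bounded f S :
  measurable S -> bounded_by M f -> bounded_by M (f \_ S).
Proof.
move=> mS [mf fM]; split.
  by apply/(measurable_restrictT _ _).1 => //; exact: measurable_funTS.
by move=> y; rewrite /patch; case: ifPn => // _; rewrite lexx ltW.
Qed.

Lemma restrict_le f S y : bounded_by M f -> (f \_ S) y <= f y.
Proof. by move=> [_ /(_ y)/andP[f0 _]]; rewrite /patch; case: ifPn. Qed.

(** Off [S] the restricted reward is 0, and the integral of a nonnegative iterate wins the
    maximum. *)
Lemma snell_restrict_notin Q f S k t x : measurable S -> bounded_by M f -> ~ S x ->
  snell Q (f \_ S) S k.+1 t x = \int[Q x]_y snell Q (f \_ S) S k t.+1 y.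
Proof.
move=> mS bf Sx; have /negPf xS : x \notin S by apply/negP; rewrite inE.
rewrite /= {1 2}/patch xS mulr0; apply/max_idPr.
have bw := snell_boundedM Q k t.+1 mS (restrict_bounded mS bf).
by have /andP[] := Rintegral_bounded (kernel1 Q x) bw.
Qed.

Section Supermultiplicative.
Hypothesis hdelta_super : forall s t, delta t * delta s <= delta (t + s)%N.

(** The factor [delta s] passes through the maximum and the integral, so the inequality on [delta]
    is only applied to the stopping payoffs and to the starting bound. *)
Lemma snell_shift Q f S k s t x : measurable S -> bounded_by M f ->
  delta s * snell Q f S k t x <= snell Q f S k (s + t) x.
Proof.
move=> mS bf; have f0 y : 0 <= f y by have [_ /(_ y)/andP[]] := bf.
elim: k t x => [|k IH] t x /=; first by rewrite mulrA ler_wpM2r// ltW.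
have dd : delta s * (delta t * f x) <= delta (s + t) * f x.
  by rewrite mulrA ler_wpM2r.
case: ifPn => // _; rewrite maxr_pMr// ge_max !le_max dd /=; apply/orP; right.
have bw t' := snell_boundedM Q k t' mS bf.
rewrite -RintegralZl//; last exact: bounded_by_integrable (kernel1 Q x) _ (bw _).
rewrite -addnS; apply: (@le_Rintegral_bounded _ _ _ (Q x) M M) => //.
- have [mw wM] := bw t.+1; split; first exact: measurable_funM.
  move=> y; have /andP[w0 wM'] := wM y; rewrite mulr_ge0//=.
  by rewrite (le_trans _ wM')// ler_piMl.
Qed.

(* Stopping before reaching [S] is never better than continuing: by
   supermultiplicativity of [delta] the assumption at time 0 carries over to
   every later time. Hence the optimal value is that of the hitting time. *)
Lemma snell_restrict Q f S k t x : measurable S -> bounded_by M f ->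
    (forall y j, ~ S y -> f y <= snell_next Q f S j y) ->
  snell Q f S k t x = snell Q (f \_ S) S k t x.
Proof.
move=> mS bf fS; elim: k t x => [|k IH] t x //.
have [Sx|Sx] := pselect (S x); first by rewrite /= /patch (mem_set Sx).
rewrite snell_restrict_notin//= ifN; last by apply/negP; rewrite inE.
(* By induction the integral may be taken for [f] itself; what remains is that it dominates the
   first arm of the maximum. *)
under [RHS]eq_Rintegral do rewrite -IH.
have bw t' := snell_boundedM Q k t' mS bf.
apply/max_idPr.
have /(ler_wpM2l (delta_ge0 t))/le_trans := fS x k Sx; apply.
rewrite -RintegralZl//; last exact: bounded_by_integrable (kernel1 Q x) _ (bw _).
apply: (@le_Rintegral_bounded _ _ _ (Q x) M M) => //.
- have [mw wM] := bw 1%N; split; first exact: measurable_funM.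
  move=> y; have /andP[w0 wM'] := wM y; rewrite mulr_ge0//=.
  by rewrite (le_trans _ wM')// ler_piMl.
- by move=> y; rewrite -[t.+1]addn1; exact: snell_shift.
Qed.

End Supermultiplicative.

Section Limits.
Variables (Q_ : nat -> R.-pker T ~> T) (Q : R.-pker T ~> T).
Variables (f_ : nat -> T -> R) (f : T -> R).
Hypothesis bf_ : forall n, bounded_by M (f_ n).
Hypothesis bf : bounded_by M f.
Hypothesis f_f : forall x, f_ n x @[n --> \oo] --> f x.
Hypothesis Q_Q : forall x e, 0 < e ->
  \forall n \near \oo, (tv_dist (Q_ n x) (Q x) <= e%:E)%E.

(** Induction on [k]. A point of [S] eventually lies in [S_ n], so stopping is forced on both sides.
    Off [S] both arms of the limiting maximum are available, so it does not matter whether the point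
    lies in [S_ n]. *)
Lemma limsup_le_snell (S_ : nat -> set T) S k t x :
    (forall n, measurable (S_ n)) -> measurable S -> S `<=` set_liminf S_ ->
  limsup_le (fun n => snell (Q_ n) (f_ n) (S_ n) k t x) (snell Q f S k t x).
Proof.
move=> mS_ mS SS_; elim: k t x => [|k IH] t x /= e e0.
  by apply: nearW => n; rewrite lerDl ltW.
have df : \forall n \near \oo, delta t * f_ n x <= delta t * f x + e.
  have /cvgrPdist_le/(_ e e0) := @f_f x; apply: filterS => n fe.
  rewrite -lerBlDl -mulrBr (le_trans _ fe)//.
  rewrite distrC (le_trans (ler_norm _))// normrM ger0_norm//.
  by rewrite ler_piMl.
case: ifPn => xS.
  have [N _ NS] : set_liminf S_ x by apply: SS_; rewrite inE in xS.
  near=> n; rewrite mem_set; last first.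
    by apply: NS => /=; near: n; exact: nbhs_infty_ge.
  by near: n.
have ds : \forall n \near \oo,
    \int[Q_ n x]_y snell (Q_ n) (f_ n) (S_ n) k t.+1 y
    <= \int[Q x]_y snell Q f S k t.+1 y + e.
  apply: (@limsup_le_Rintegral _ _ _ _ _ M) e0 => //.
  - by move=> n; exact: snell_boundedM.
  - exact: snell_boundedM.
  - by move=> eps eps0; exact: Q_Q.
near=> n.
have dfn : delta t * f_ n x <= Num.max (delta t * f x)
    (\int[Q x]_y snell Q f S k t.+1 y) + e.
  apply: (@le_trans _ _ (delta t * f x + e)); first by near: n.
  by rewrite lerD2r le_max lexx.
case: ifPn => _ //; rewrite ge_max dfn /=.
apply: (@le_trans _ _ (\int[Q x]_y snell Q f S k t.+1 y + e)); first by near: n.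
by rewrite lerD2r le_max lexx orbT.
Unshelve. all: by end_near. Qed.

Lemma limsup_le_snell_next (S_ : nat -> set T) S k x :
    (forall n, measurable (S_ n)) -> measurable S -> S `<=` set_liminf S_ ->
  limsup_le (fun n => snell_next (Q_ n) (f_ n) (S_ n) k x) (snell_next Q f S k x).
Proof.
move=> mS_ mS SS_; apply: (@limsup_le_Rintegral _ _ _ _ _ M) => //.
- by move=> n; exact: snell_boundedM.
- exact: snell_boundedM.
- by move=> eps eps0; exact: Q_Q.
- by move=> y; exact: limsup_le_snell.
Qed.

End Limits.

End SnellEnvelope.

(** * The value of a hitting time through the Markov property *)

Section HittingTimeValue.
Context {R : realType} {dT dO : measure_display}.
Context {T : measurableType dT} {Omega : measurableType dO}.
Variables (delta : nat -> R) (M : R).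
Hypothesis hdelta : discount_function delta.
Hypothesis M_gt0 : 0 < M.
Hypothesis measurable_points : forall x : T, measurable [set x].
Variables (Q : R.-pker T ~> T) (X : nat -> Omega -> T).
Variable P : T -> probability Omega R.
Hypothesis hX : markov_process Q X P.
Variable S : set T.
Hypothesis mS : measurable S.
Variable f : T -> R.
Hypothesis bf : bounded_by M f.

Local Notation rho := (hitting_time X S).
Local Notation payoff := (stopped_reward delta X f rho).
Local Notation w_S := (snell delta M Q (f \_ S) S).

(** Survival is tested from time 1 on, as in [hitting_time]; at [t = 0] it is no condition at all,
    even when the process starts in [S]. *)
Definition alive (t : nat) : set Omega :=
  [set w | forall s, (1 <= s <= t)%N -> ~ S (X s w)].

Let delta_ge0 t : 0 <= delta t.
Proof. by have [/(_ t)/andP[]] := hdelta. Qed.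

Let delta_le1 t : delta t <= 1.
Proof. by have [/(_ t)/andP[]] := hdelta. Qed.

Let mX t : measurable_fun setT (X t).
Proof. by have [] := hX. Qed.

Let mXS t : measurable (X t @^-1` S).
Proof. by rewrite -[X in measurable X]setTI; exact: mX. Qed.

Let P1 x : P x setT = 1%E.
Proof. exact: probability_setT. Qed.

Let bfS : bounded_by M (f \_ S).
Proof. exact: restrict_bounded. Qed.

Lemma natural_filtration_measurable t A :
  natural_filtration X t A -> measurable A.
Proof.
apply: smallest_sub; first exact: sigma_algebra_measurable.
by move=> _ [s st [B mB ->]]; rewrite -[X in measurable X]setTI; exact: mX.
Qed.

(** Makes the Markov property applicable on [alive t]. The complement is a finite union of hitting
    events, padded with empty sets to a countable one. *)
Lemma alive_natural_filtration t : natural_filtration X t (alive t).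
Proof.
rewrite (_ : alive t = setT `\`
    \bigcup_s (if (1 <= s <= t)%N then X s @^-1` S else set0)).
  apply: sigma_algebraCD; apply: sigma_algebra_bigcup => s.
  case: ifPn => [/andP[_ st]|_]; last exact: sigma_algebra0.
  by apply: sub_sigma_algebra; exists s => //; exists S.
apply/seteqP; split => w /= aw.
- by split => // -[s _]; case: ifPn => // st; exact: aw.
- move=> s st Sw; case: aw => _; apply; exists s => //.
  by rewrite st.
Qed.

Let malive t : measurable (alive t).
Proof. exact: natural_filtration_measurable (@alive_natural_filtration t). Qed.

Lemma alive0 : alive 0 = setT.
Proof. by apply/seteqP; split => // w _ s; case: s. Qed.

Lemma aliveS t : alive t.+1 = alive t `\` X t.+1 @^-1` S.
Proof.
apply/seteqP; split => w /= aw.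
- split; last by apply: aw; rewrite leqnn.
  by move=> s /andP[s1 st]; apply: aw; rewrite s1 ltnW.
- have [aw' Sw] := aw => s /andP[s1]; rewrite leq_eqVlt => /predU1P[->//|st].
  by apply: aw'; rewrite s1.
Qed.

Lemma payoff_hit t w : alive t w -> S (X t.+1 w) ->
  payoff w = delta t.+1 * f (X t.+1 w).
Proof.
move=> aw Sw; rewrite /stopped_reward /hitting_time.
case: pselect => [h|[]]; last by exists t.+1; apply/asboolP.
case: ex_minnP => m /asboolP[m1 Sm] mmin.
suff -> : m = t.+1 by [].
apply/eqP; rewrite eqn_leq; apply/andP; split.
  by apply: mmin; apply/asboolP.
by rewrite ltnNge; apply/negP => mt; apply: (aw m) => //; rewrite m1.
Qed.

Lemma payoff_never w : (forall t, alive t w) -> payoff w = 0.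
Proof.
move=> aw; rewrite /stopped_reward /hitting_time.
case: pselect => // h; case: ex_minnP => m /asboolP[m1 Sm] _.
by case: (aw m m) => //; rewrite m1 leqnn.
Qed.

Lemma alive_or_hit w :
  (forall s, alive s w) \/ exists s, alive s w /\ S (X s.+1 w).
Proof.
have [aw|/existsNP[s aw]] := pselect (forall s, alive s w); [by left|right].
elim: s aw => [|s IH]; first by rewrite alive0 => /(_ I).
rewrite aliveS => /not_andP[/IH//|/contrapT Sw].
have [as_|/IH//] := pselect (alive s w).
by exists s.
Qed.

(** Only hits at times [t + 1] to [t + k] are paid. The recursion avoids [hitting_time], so
    measurability follows by induction. *)
Fixpoint truncated_payoff (k t : nat) (w : Omega) : R :=
  if k is k'.+1 then
    if X t.+1 w \in S then delta t.+1 * f (X t.+1 w) else truncated_payoff k' t.+1 w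
  else 0.

Let mfX t : measurable_fun setT (fun w => f (X t w)).
Proof. by have [mf _] := bf; exact: measurableT_comp. Qed.

Lemma measurable_truncated_payoff k t :
  measurable_fun setT (truncated_payoff k t).
Proof.
elim: k t => [|k IH] t /=; first exact: measurable_cst.
apply: measurable_fun_ifT => //.
- exact: (measurableT_comp (measurable_fun_mem mS) (mX t.+1)).
- exact: measurable_funM.
Qed.

Lemma truncated_payoff_hit k t w s : alive (s + t) w -> S (X (s + t).+1 w) ->
  (s < k)%N -> truncated_payoff k t w = delta (s + t).+1 * f (X (s + t).+1 w).
Proof.
elim: s k t => [|s IH] [|k] t //= aw Sw sk.
  by rewrite add0n in Sw *; rewrite (mem_set Sw).
rewrite ifN; last first.
  apply/negP; rewrite inE; apply: aw.
  by rewrite /= addSn ltnS leq_addl.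
by rewrite addSnnS in aw Sw *; exact: IH.
Qed.

Lemma truncated_payoff_never k t w :
  (forall s, alive s w) -> truncated_payoff k t w = 0.
Proof.
move=> aw; elim: k t => //= k IH t; rewrite ifN//.
by apply/negP; rewrite inE; apply: (aw t.+1); rewrite leqnn.
Qed.

(** A path alive at [t] can hit [S] no earlier than [t + 1], and [delta] decreases. *)
Lemma payoff_bounded_alive t w : alive t w -> 0 <= payoff w <= delta t.+1 * M.
Proof.
have [_ fM] := bf; move=> aw.
have [nw|[s [asw Sw]]] := alive_or_hit w.
  by rewrite payoff_never// lexx mulr_ge0// ltW.
rewrite (payoff_hit asw Sw); have /andP[f0 fM'] := fM (X s.+1 w).
rewrite mulr_ge0//=.
have ts : (t <= s)%N.
  by rewrite leqNgt; apply/negP => st; apply: (aw s.+1).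
apply: ler_pM => //; have [_ ddecr _ _ _] := hdelta.
by apply: ddecr; rewrite ltnS.
Qed.

Lemma payoff_bounded : bounded_by M payoff.
Proof.
split; last first.
  move=> w; have /andP[-> /le_trans] : 0 <= payoff w <= delta 1 * M.
    by apply: payoff_bounded_alive; rewrite alive0.
  by apply; rewrite ler_piMl// ltW.
(* Along each path the truncated payoffs are eventually equal to the payoff, which is therefore a
   pointwise limit of measurable functions. *)
apply: (measurable_fun_cvg (fun k => measurable_truncated_payoff k 0)) => w _.
apply: cvg_near_cst.
have [nw|[s [asw Sw]]] := alive_or_hit w.
  by apply: nearW => k; rewrite payoff_never// truncated_payoff_never.
rewrite (payoff_hit asw Sw); near=> k.
rewrite (@truncated_payoff_hit k 0 w s) ?addn0//.
by near: k; exact: nbhs_infty_gt.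
Unshelve. all: by end_near. Qed.

(** The law of [X t.+1] under [P x] restricted to [A] is disintegrated twice: along [Q (X t w)], by
    the Markov property, and along the Dirac mass at [X t.+1 w], which gives the left side. *)
Lemma markov_integral x t A C (g : T -> R) :
    natural_filtration X t A -> bounded_by C g ->
  \int[P x]_(w in A) g (X t.+1 w) = \int[P x]_(w in A) \int[Q (X t w)]_y g y.
Proof.
move=> FA bg; have [mg gC] := bg.
have mA := natural_filtration_measurable FA.
have g0 y : (0 <= (g y)%:E)%E by rewrite lee_fin; have /andP[] := gC y.
have meg : measurable_fun setT (fun y => (g y)%:E) by exact/measurable_EFinP.
have nuE B : measurable B ->
    pushforward (mrestr (P x) mA) (X t.+1) B = (P x (A `&` X t.+1 @^-1` B)).
  by move=> mB; rewrite /pushforward /mrestr setIC.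
congr fine.
under [RHS]eq_integral do rewrite (EFin_Rintegral (prob_kernel _) measurableT bg).
have mdirac B : measurable B ->
    measurable_fun setT (fun w => \d_(X t.+1 w) B : \bar R)%E.
  move=> mB; apply/measurable_EFinP.
  by apply: (measurableT_comp (measurable_indic mB)); exact: mX.
have mQX B : measurable B -> measurable_fun setT (fun w => Q (X t w) B).
  by move=> mB; exact: (measurableT_comp (measurable_kernel Q _ mB)).
rewrite -(ge0_disintegration mQX mA (nu := pushforward (mrestr (P x) mA) (X t.+1)))//; last first.
  by move=> B mB; apply: (etrans (nuE B mB)); have [_ _ ->] := hX.
rewrite (ge0_disintegration mdirac mA (mu := P x))//; last first.
  move=> B mB; apply: (etrans (nuE B mB)); rewrite setIC -integral_indic//.
  by rewrite -[X in measurable X]setTI; exact: mX.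
by apply: eq_integral => w _; rewrite integral_dirac// diracT mul1e.
Qed.

(** By the Markov property, this is the conditional expectation of [w_S k t.+1] at [X t.+1] given
    the path up to time [t]. *)
Let next (k t : nat) (w : Omega) : R := \int[Q (X t w)]_y w_S k t.+1 y.

Let bw k t : bounded_by M (w_S k t).
Proof. exact: snell_boundedM. Qed.

Let bnext k t : bounded_by M (next k t).
Proof.
split.
  by apply: (measurableT_comp (measurable_fun_Rintegral_kernel Q (bw k t.+1))).
by move=> w; exact: (Rintegral_bounded (prob_kernel _) (bw k t.+1)).
Qed.

(* On [alive t], the Markov property trades [next k.+1 t] for the payoff of the
   paths that hit [S] at time [t + 1] plus [next k t.+1] on [alive t.+1]. *)
Lemma payoff_sandwich x k t :
  \int[P x]_(w in alive t) payoff w <= \int[P x]_(w in alive t) next k t w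
  <= \int[P x]_(w in alive t) payoff w + delta (t + k).+1 * M.
Proof.
have int D C (g : Omega -> R) : measurable D -> bounded_by C g ->
    (P x).-integrable D (EFin \o g).
  by move=> mD bg; exact: bounded_by_integrable (P1 x) mD bg.
elim: k t => [|k IH] t.
  (* With no iteration left the value is the constant [delta t.+1 * M]: it dominates the payoff on
     [alive t], and serves itself as the error term. *)
  have nextE w : next 0 t w = delta t.+1 * M.
    by rewrite /next/= (Rintegral_prob_cst _ (prob_kernel _)).
  apply/andP; split.
    apply: le_Rintegral => //; [exact: int payoff_bounded|exact: int (bnext 0 t)|].
    by move=> w aw; rewrite nextE; have /andP[] := payoff_bounded_alive aw.
  rewrite -[leLHS]add0r; apply: lerD.
    by apply: Rintegral_ge0 => w _; have [_ /(_ w)/andP[]] := payoff_bounded.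
  rewrite (@eq_Rintegral _ _ _ _ _ (cst (delta t.+1 * M))); last by move=> w _.
  rewrite Rintegral_cst// addn0 ler_piMr//; first by rewrite mulr_ge0// ltW.
  by rewrite -lee_fin fineK ?probability_le1// fin_num_measure.
have aliveE : alive t = (alive t `&` X t.+1 @^-1` S) `|` alive t.+1.
  by rewrite aliveS setUIDK.
have split_alive (g : Omega -> R) C : bounded_by C g ->
    \int[P x]_(w in alive t) g w =
    \int[P x]_(w in alive t `&` X t.+1 @^-1` S) g w + \int[P x]_(w in alive t.+1) g w.
  move=> bg; rewrite {1}aliveE Rintegral_setU//.
  - exact: measurableI.
  - by rewrite -aliveE; exact: int bg.
  - rewrite aliveS; apply/disj_setPS => w [[_ ?] []].
    by [].
have /andP[IH1 IH2] := IH t.+1.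
have -> : \int[P x]_(w in alive t) next k.+1 t w =
    \int[P x]_(w in alive t `&` X t.+1 @^-1` S) payoff w +
    \int[P x]_(w in alive t.+1) next k t.+1 w.
  rewrite /next -(markov_integral x (@alive_natural_filtration t) (bw k.+1 t.+1)).
  rewrite (split_alive _ M); last first.
    have [mw wM] := bw k.+1 t.+1.
    by split => //; exact: (measurableT_comp mw).
  congr (_ + _); apply: eq_Rintegral => w; rewrite inE.
  - by move=> [aw Sw]; rewrite (payoff_hit aw Sw) /= /patch mem_set.
  - rewrite aliveS => -[_ Sw].
    rewrite snell_restrict_notin//.
(* The contribution of the hits at [t + 1] cancels throughout, and the error index is unchanged
   since [t + 1 + k] equals [t + (k + 1)]. *)
rewrite (split_alive _ _ payoff_bounded) lerD2l IH1 -addrA lerD2l.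
by rewrite -addSnnS.
Qed.

(** The case [t = 0] of [payoff_sandwich]. As [X 0] equals [x] almost surely, the integral of
    [next k 0] reduces to its value at [x]. *)
Lemma continuation_value_sandwich x k :
  (continuation_value delta X P x S f <= (snell_next delta M Q (f \_ S) S k x)%:E
   <= continuation_value delta X P x S f + (delta k.+1 * M)%:E)%E.
Proof.
have := payoff_sandwich x k 0; rewrite alive0 add0n.
have -> : \int[P x]_w next k 0 w = snell_next delta M Q (f \_ S) S k x.
  rewrite -(Rintegral_prob_cst (snell_next delta M Q (f \_ S) S k x) (P1 x)).
  congr fine; apply: ae_eq_integral => //.
    by apply/measurable_EFinP; have [] := bnext k 0.
  have mx : measurable (X 0%N @^-1` [set x]).
    by rewrite -[X in measurable X]setTI; apply: mX.
  exists (~` (X 0%N @^-1` [set x])); split.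
  - exact: measurableC.
  - by apply: (etrans (probability_setC (P x) mx)); have [_ -> _] := hX; rewrite subee.
  - move=> w /= + Xw; apply.
    by move=> _; rewrite /next Xw.
by rewrite /continuation_value -(EFin_Rintegral (P1 x) measurableT payoff_bounded) -EFinD !lee_fin.
Qed.

End HittingTimeValue.

(** * Construction and properties of the least equilibrium *)

Section LeastEquilibrium.
Context {R : realType} {dT dO : measure_display}.
Context {T : measurableType dT} {Omega : measurableType dO}.
Variables (delta : nat -> R) (M : R).
Hypothesis hdelta : discount_function delta.
Hypothesis M_gt0 : 0 < M.
Implicit Types (Q : R.-pker T ~> T) (S E : set T) (f : T -> R).

(** Entry is certified by a single [k] and a strict inequality: this keeps the stages measurable and
    leaves a gap that absorbs perturbations. *)
Fixpoint stop_set Q f (m : nat) : set T :=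
  if m is m'.+1 then
    stop_set Q f m' `|`
    [set x | exists k, snell_next delta M Q f (stop_set Q f m') k x < f x]
  else set0.

Definition least_equilibrium Q f : set T := \bigcup_m stop_set Q f m.

Lemma measurable_stop_set Q f m : bounded_by M f -> measurable (stop_set Q f m).
Proof.
move=> bf; have [mf _] := bf; elim: m => [|m IH] /=; first exact: measurable0.
apply: measurableU => //.
rewrite (_ : [set x | _] = \bigcup_k ((fun x =>
    snell_next delta M Q f (stop_set Q f m) k x < f x) @^-1` [set true])).
  apply: bigcup_measurable => k _; rewrite -[X in measurable X]setTI.
  apply: measurable_fun_ltr => //; exact: measurable_snell_next.
by apply/seteqP; split => x /= [k]; [move=> xk; exists k|move=> _ xk; exists k].
Qed.

Lemma measurable_least_equilibrium Q f :
  bounded_by M f -> measurable (least_equilibrium Q f).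
Proof. by move=> bf; apply: bigcup_measurable => m _; exact: measurable_stop_set. Qed.

Lemma stop_set_least_equilibrium Q f m : stop_set Q f m `<=` least_equilibrium Q f.
Proof. by move=> x xm; exists m. Qed.

Lemma le_stop_set Q f m n : (m <= n)%N -> stop_set Q f m `<=` stop_set Q f n.
Proof. by move=> /subnK <-; elim: (n - m)%N => // k IH x /IH; left. Qed.

Lemma least_equilibrium_witness Q f x : least_equilibrium Q f x ->
  exists m k, snell_next delta M Q f (stop_set Q f m) k x < f x.
Proof. by move=> [m _]; elim: m => // m IH /= [/IH//|[k xk]]; exists m, k. Qed.

Lemma discount_small e : 0 < e -> exists k, delta k.+1 * M <= e.
Proof.
move=> e0; have [_ ddecr _ _ d0] := hdelta.
have /cvgrPdist_le/(_ (e / M) (divr_gt0 e0 M_gt0)) [k _ /(_ k (leqnn k))] := d0.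
rewrite sub0r normrN => dk; exists k; rewrite -ler_pdivlMr//.
apply: le_trans dk; apply: le_trans (ler_norm _); exact: ddecr.
Qed.

Lemma least_equilibrium_set_liminf (Q_ : nat -> R.-pker T ~> T) Q (f_ : nat -> T -> R) f :
    (forall n, bounded_by M (f_ n)) -> bounded_by M f ->
    (forall x, f_ n x @[n --> \oo] --> f x) ->
    (forall x e, 0 < e -> \forall n \near \oo, (tv_dist (Q_ n x) (Q x) <= e%:E)%E) ->
  least_equilibrium Q f `<=` set_liminf (fun n => least_equilibrium (Q_ n) (f_ n)).
Proof.
move=> bf_ bf f_f Q_Q.
suff sub m : stop_set Q f m `<=` set_liminf (fun n => stop_set (Q_ n) (f_ n) m).
  move=> x [m _ /sub [N _ xN]]; exists N => // j Nj.
  exact: stop_set_least_equilibrium (xN j Nj).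
elim: m => // m IH x /= [/IH [N _ xN]|[k xk]].
  by exists N => // j Nj; left; exact: xN.
(* A third of the gap goes to the iterate and a third to the reward; the last third keeps the
   inequality strict. *)
pose e := (f x - snell_next delta M Q f (stop_set Q f m) k x) / 3.
have e0 : 0 < e by rewrite divr_gt0// subr_gt0.
have le_next : \forall n \near \oo,
    snell_next delta M (Q_ n) (f_ n) (stop_set (Q_ n) (f_ n) m) k x
    <= snell_next delta M Q f (stop_set Q f m) k x + e.
  apply: (limsup_le_snell_next hdelta M_gt0 bf_ bf) e0 => //.
  - by move=> n; exact: measurable_stop_set.
  - exact: measurable_stop_set.
have le_f : \forall n \near \oo, `|f x - f_ n x| <= e.
  by have /cvgrPdist_le/(_ e e0) := f_f x.
have [N _ HN] : \forall n \near \oo,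
    snell_next delta M (Q_ n) (f_ n) (stop_set (Q_ n) (f_ n) m) k x < f_ n x.
  near=> n; apply: (@le_lt_trans _ _
    (snell_next delta M Q f (stop_set Q f m) k x + e)); first by near: n.
  apply: (@lt_le_trans _ _ (f x - e)); last first.
    rewrite lerBlDr -lerBlDl (le_trans (ler_norm _))//.
    by near: n.
  by rewrite ltrBrDr -addrA -ltrBrDl /e; lra.
by exists N => // j Nj; right; exists k; exact: HN.
Unshelve. all: by end_near. Qed.

Lemma tv_distxx (mu : {measure set T -> \bar R}) (e : R) :
  mu setT = 1%E -> 0 < e -> (tv_dist mu mu <= e%:E)%E.
Proof.
move=> mu1 e0; apply: ge_ereal_sup => _ [g [mg g01] <-].
by rewrite -(@EFin_Rintegral _ _ _ _ _ 1)// -EFinB subrr lee_fin ltW.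
Qed.

(** Semicontinuity is applied to constant [Q] and [f] and to the increasing stages. A strict reverse
    inequality at a stage [N] would put [x] into stage [N + 1]. *)
Lemma le_snell_next_least_equilibrium Q f x k : bounded_by M f ->
  ~ least_equilibrium Q f x -> f x <= snell_next delta M Q f (least_equilibrium Q f) k x.
Proof.
move=> bf nx; apply/ler_addgt0Pr => e e0.
have [N _ HN] : \forall m \near \oo, snell_next delta M Q f (stop_set Q f m) k x
    <= snell_next delta M Q f (least_equilibrium Q f) k x + e.
  apply: (@limsup_le_snell_next _ _ _ delta M hdelta M_gt0 (cst Q) Q (cst f) f) => //.
  - by move=> y; exact: cvg_cst.
  - move=> y eps eps0; apply: nearW => n /=; apply: tv_distxx => //.
    exact: prob_kernel.
  - by move=> n; exact: measurable_stop_set.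
  - exact: measurable_least_equilibrium.
  - by move=> y [m _ ym]; exists m => // j mj; exact: le_stop_set ym.
apply: le_trans (HN N (leqnn N)); rewrite leNgt; apply/negP => xN.
by apply: nx; exists N.+1 => //; right; exists k.
Qed.

Section Process.
Hypothesis measurable_points : forall x : T, measurable [set x].
Variables (Q : R.-pker T ~> T) (X : nat -> Omega -> T).
Variable P : T -> probability Omega R.
Hypothesis hX : markov_process Q X P.
Variable f : T -> R.
Hypothesis bf : bounded_by M f.
Hypothesis hdelta_super : forall s t, delta t * delta s <= delta (t + s)%N.

Local Notation S0 := (least_equilibrium Q f).
Local Notation cont := (continuation_value delta X P).

Let mS0 : measurable S0.
Proof. exact: measurable_least_equilibrium. Qed.

Let sandwich x E k (mE : measurable E) :=
  continuation_value_sandwich hdelta M_gt0 measurable_points hX mE bf x k.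

(** Waiting to hit [E] is one strategy among those allowed when stopping is forced only on [S];
    formally, [f \_ E] lies below [f], and [S] inside [E]. *)
Lemma continuation_value_le_snell_next x S E k :
    measurable S -> measurable E -> S `<=` E ->
  (cont x E f <= (snell_next delta M Q f S k x)%:E)%E.
Proof.
move=> mS mE SE; have /andP[/le_trans + _] := sandwich x k mE; apply.
rewrite lee_fin; apply: le_snell_next => //; first exact: restrict_bounded.
by move=> y; exact: restrict_le bf.
Qed.

(** Induction on stages: a point entering outside [E] would have continuation value below [f x],
    against the equilibrium condition for [E]. *)
Lemma least_equilibrium_sub E : equilibria delta X P f E -> S0 `<=` E.
Proof.
move=> [mE fE _] x [m _]; elim: m x => // m IH x /= [/IH//|[k xk]].
apply: contrapT => /fE; apply/negP; rewrite -ltNge.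
by apply: le_lt_trans (continuation_value_le_snell_next x k
  (measurable_stop_set Q m bf) mE IH) _.
Qed.

(** On [S0] the iterates for [f] and for [f \_ S0] coincide by [snell_restrict], so the upper half
    of the sandwich applies to [f]. *)
Lemma snell_next_le_continuation_value x k :
  ((snell_next delta M Q f S0 k x)%:E <= cont x S0 f + (delta k.+1 * M)%:E)%E.
Proof.
have /andP[_] := sandwich x k mS0; apply: le_trans; rewrite lee_fin.
rewrite le_eqVlt; apply/orP; left; apply/eqP; apply: eq_Rintegral => y _.
apply: (snell_restrict hdelta M_gt0 hdelta_super) => // z j.
exact: le_snell_next_least_equilibrium.
Qed.

Lemma least_equilibrium_equilibrium : equilibria delta X P f S0.
Proof.
split => // x Sx.
- apply/lee_addgt0Pr => e /discount_small[k dk].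
  apply: (@le_trans _ _ (snell_next delta M Q f S0 k x)%:E).
    by rewrite lee_fin; exact: le_snell_next_least_equilibrium.
  apply: le_trans (snell_next_le_continuation_value x k) _.
  by rewrite leeD2l// lee_fin.
- have [m [k xk]] := least_equilibrium_witness Sx.
  apply: (@le_trans _ _ (snell_next delta M Q f (stop_set Q f m) k x)%:E).
    apply: continuation_value_le_snell_next => //; first exact: measurable_stop_set.
    exact: stop_set_least_equilibrium.
  by rewrite lee_fin ltW.
Qed.

Lemma Sstar_least_equilibrium : Sstar delta X P f = S0.
Proof.
apply/seteqP; split => [x|x Sx E]; last by move/least_equilibrium_sub; exact.
by apply; exact: least_equilibrium_equilibrium.
Qed.

Lemma V_le_snell x k : (V delta X P x f <= (snell delta M Q f S0 k.+1 0 x)%:E)%E.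
Proof.
have [_ _ d0 _ _] := hdelta.
apply: ge_ereal_sup => _ [E eqE <-]; have SE := least_equilibrium_sub eqE.
have [mE _ _] := eqE; rewrite /J /= d0 mul1r.
case: ifPn => xE; case: ifPn => xS.
- by [].
- by rewrite lee_fin le_max lexx.
- by move/negP : xE; rewrite !inE in xS *; case; exact: SE.
- apply: (le_trans (continuation_value_le_snell_next x k mS0 mE SE)).
  by rewrite lee_fin le_max lexx orbT.
Qed.

Lemma snell_le_V x k :
  ((snell delta M Q f S0 k.+1 0 x)%:E <= V delta X P x f + (delta k.+1 * M)%:E)%E.
Proof.
have [dge0 _ d0 _ _] := hdelta.
have JV : (J delta X P x S0 f <= V delta X P x f)%E.
  by apply: ereal_sup_ubound; exists S0 => //; exact: least_equilibrium_equilibrium.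
apply: (le_trans _ (leeD JV (le_refl _))).
rewrite /J /= d0 mul1r; case: ifPn => xS.
  rewrite leeDl// lee_fin mulr_ge0//; last exact: ltW.
  by have /andP[] := dge0 k.+1.
rewrite (max_idPr _); first exact: snell_next_le_continuation_value.
apply: le_snell_next_least_equilibrium => //.
by move/negP : xS; rewrite inE.
Qed.

End Process.

End LeastEquilibrium.

(** * Topological and limit facts, and the convergence theorem *)

Lemma borel_measurable_set1 (T : ptopologicalType) (x : borel T) :
  hausdorff_space T -> measurable [set x].
Proof.
move=> hT; rewrite -[X in measurable X]setCK; apply: measurableC.
apply: sub_sigma_algebra; rewrite openC.
exact: (accessible_closed_set1 (hausdorff_accessible hT)).
Qed.

(** The set of all [n] with [u n <= b] belongs to the filter at infinity and competes in the
    infimum. *)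
Lemma limn_esup_le (R : realType) (u : nat -> \bar R) (b : \bar R) :
  (\forall n \near \oo, (u n <= b)%E) -> (limn_esup u <= b)%E.
Proof.
move=> ub; rewrite /limn_esup limf_esupE.
apply: (@le_trans _ _ (ereal_sup [set u n | n in [set n | (u n <= b)%E]])).
  by apply: ereal_inf_lbound; exists [set n | (u n <= b)%E].
by apply: ge_ereal_sup => _ [n un <-].
Qed.

Lemma locally_uniformly_to0_pointwise (R : realType) (T : topologicalType)
    (h : nat -> T -> \bar R) (x : T) :
  locally_uniformly_to0 h -> h n x @[n --> \oo] --> (0 : \bar R)%E.
Proof.
move=> /(_ _ (finite_compact (finite_set1 x))) hx.
have : ereal_sup [set h n y | y in [set x]] @[n --> \oo] --> (0 : \bar R)%E.
  by apply: hx; exists x.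
by under eq_fun do rewrite image_set1 ereal_sup1.
Qed.

Lemma reward_bounded_by (R : realType) (d : measure_display)
    (T : measurableType d) (I : Type) (f : I -> T -> R) :
    (forall n, reward (f n)) ->
    (ereal_sup [set sup_norm (f n) | n in [set: I]] < +oo)%E ->
  exists2 M, 0 < M & forall n, bounded_by M (f n).
Proof.
move=> hf; set s := ereal_sup _ => soo.
have fs n x : ((f n x)%:E <= s)%E.
  apply: (@le_trans _ _ (sup_norm (f n))); last by apply: ereal_sup_ubound; exists n.
  by apply: ereal_sup_ubound; exists x => //=; rewrite ger0_norm//; have [_] := hf n.
(* The maximum with 1 keeps [M] positive even when all rewards vanish. *)
exists (Num.max 1 (fine s)); first by rewrite lt_max ltr01.
move=> n; have [mf f0] := hf n; split => // x; rewrite f0 le_max /=.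
apply/orP; right; rewrite -lee_fin fineK//.
by rewrite fin_numElt soo andbT (lt_le_trans _ (fs n x))// ltNyr.
Qed.

Unset Implicit Arguments.

Theorem theorem3p1 (R : realType) (T : completePseudoMetricType R)
    (hT : polish T)
    (delta : nat -> R) (hdelta : discount_function delta)
    (hdelta_super : forall s t : nat, delta t * delta s <= delta (t + s)%N)
    (Q : natbar -> R.-pker (borel T) ~> (borel T))
    (dO : measure_display) (Omega : measurableType dO)
    (X : nat -> Omega -> borel T)
    (P : natbar -> borel T -> probability Omega R)
    (hX : forall n : natbar, markov_process (Q n) X (P n))
    (f : natbar -> borel T -> R)
    (hf : forall n : natbar, reward (f n))
    (hf_bounded : (ereal_sup [set sup_norm (f n) | n in [set: natbar]] < +oo)%E)
    (hQ_cvg : locally_uniformly_to0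
      (fun (n : nat) (x : T) => tv_dist (Q (Some n) x) (Q None x)))
    (hf_cvg : locally_uniformly_to0
      (fun (n : nat) (x : T) => (`|f (Some n) x - f None x|)%:E)) :
  Sstar delta X (P None) (f None)
    `<=` set_liminf (fun n : nat => Sstar delta X (P (Some n)) (f (Some n)))
  /\
  forall x : borel T,
    (limn_esup (fun n : nat => V delta X (P (Some n)) x (f (Some n)))
      <= V delta X (P None) x (f None))%E.
Proof.
have [M M_gt0 bf] := reward_bounded_by hf hf_bounded.
have [Thaus _] := hT.
have mpt (x : borel T) : measurable [set x] by exact: borel_measurable_set1.
have f_f (x : borel T) : f (Some n) x @[n --> \oo] --> f None x.
  have /fine_cvgP[_] := locally_uniformly_to0_pointwise x hf_cvg.
  move=> /cvgrPdist_le fx; apply/cvgrPdist_le => e /fx.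
  by apply: filterS => n /=; rewrite sub0r normrN normr_id distrC.
have Q_Q (x : borel T) (e : R) : 0 < e ->
    \forall n \near \oo, (tv_dist (Q (Some n) x) (Q None x) <= e%:E)%E.
  move=> e0; have /fine_cvgP[fin] := locally_uniformly_to0_pointwise x hQ_cvg.
  move=> /cvgrPdist_le/(_ e e0); move: fin; apply: filterS2 => n fin.
  by rewrite /= sub0r normrN => /(le_trans (ler_norm _)); rewrite -lee_fin fineK.
have SE n := Sstar_least_equilibrium hdelta M_gt0 mpt (hX n) (bf n) hdelta_super.
pose S n := least_equilibrium delta M (Q n) (f n).
have SS : S None `<=` set_liminf (fun n : nat => S (Some n)).
  exact: (least_equilibrium_set_liminf hdelta M_gt0 (fun n => bf (Some n)) (bf None) f_f Q_Q).
split.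
  rewrite SE (_ : (fun n : nat => _) = (fun n : nat => S (Some n)))//.
  by apply/funext => n; exact: SE.
move=> x; apply/lee_addgt0Pr => e e0.
have e20 : 0 < e / 2 by rewrite divr_gt0.
(* The depth [k] is fixed before [n], and only then is semicontinuity used at this depth; each of
   the two costs [e / 2]. *)
have [k dk] := discount_small hdelta M_gt0 e20.
apply: limn_esup_le.
have := limsup_le_snell hdelta M_gt0 (fun n => bf (Some n)) (bf None) f_f Q_Q k.+1 0 x
  (fun n => measurable_least_equilibrium hdelta M_gt0 (Q (Some n)) (bf (Some n)))
  (measurable_least_equilibrium hdelta M_gt0 (Q None) (bf None)) SS.
move=> /(_ _ e20); apply: filterS => n sn.
apply: le_trans (V_le_snell hdelta M_gt0 mpt (hX (Some n)) (bf (Some n)) x k) _.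
apply: (@le_trans _ _ (snell delta M (Q None) (f None) (S None) k.+1 0 x + e / 2)%:E).
  by rewrite lee_fin.
rewrite EFinD [in leRHS](splitr e) EFinD addeA leeD2r//.
apply: le_trans (snell_le_V hdelta M_gt0 mpt (hX None) (bf None) hdelta_super x k) _.
by rewrite leeD2l// lee_fin.
Qed.
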